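(* Let $G=(V,E)$ be a finite undirected graph with $n=|V|$, let $d:E\to\mathbb{R}^+$, let $k,\alpha\ge 2$ be integers, and put $\beta=n-(k-1)\alpha$. Let $C\subset V$ be such that $(C,E(C))$ is a clique with $|C|>k$, where $E(C)$ is the set of edges of $G$ with both end nodes in $C$. Let $q=|C|-k$. Then $$\sum_{c\in[k]}\ \sum_{\{i,j\}\in E(C)}x_{ij}^c\ \ge\ \begin{cases}\max\left\{\left\lfloor\frac{|C|}{2}\right\rfloor\left(\left\lfloor\frac{|C|}{2}\right\rfloor-1\right),\,q\right\}&\text{if }k=2,\\[2pt] q&\text{if }k>2,\end{cases}$$ is a valid inequality for the model $(\mathcal{M}_1)$, and $$\sum_{\{i,j\}\in E(C)}x_{ij}\ \ge\ \begin{cases}\max\left\{\left\lfloor\frac{|C|}{2}\right\rfloor\left(\left\lfloor\frac{|C|}{2}\right\rfloor-1\right),\,q\right\}&\text{if }k=2,\\[2pt] q&\text{if }k>2,\end{cases}$$ is a valid inequality for the model $(\mathcal{M}_2)$.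
   Context: Notation: $V=\{1,\dots,n\}$, $[k]=\{1,\dots,k\}$, $\bar E=\{\{i,j\}\notin E: i,j\in V, i\ne j\}$. An (in)equality is valid for a model if every feasible solution of the model satisfies it. Each edge $\{i,j\}$ has two associated antiparallel arcs $(i,j)$, $(j,i)$; $\delta^-_j$ and $\delta^+_j$ are the sets of arcs entering and leaving node $j$. Variables indexed by edges are symmetric ($x_{ij}=x_{ji}$); flow variables are indexed by arcs. Both models describe partitions of $V$ into $k$ sets $V_1,\dots,V_k$ (with $y_i^c=1$ iff $i\in V_c$), each inducing a connected subgraph and having at least $\alpha$ nodes, minimizing the total cost of edges with both ends in the same set. Model $(\mathcal{M}_1)$: variables $y_i^c\in\{0,1\}$ ($i\in V,c\in[k]$), $x_{ij}^c\in\{0,1\}$ ($\{i,j\}\in E,c\in[k]$), $\bar x_{ij}^c\in\{0,1\}$ ($\{i,j\}\in\bar E,c\in[k]$), and $f_{ij}^{lc}\ge 0$ real for both arcs $(i,j)$ of each edge of $E$, $l\in V$, $c\in[k]$. Minimize $\sum_{c\in[k]}\sum_{\{i,j\}\in E}d_{ij}x_{ij}^c$ subject to: (1) $\sum_{c\in[k]}y_i^c=1$ for all $i\in V$; (2) $y_i^c+y_j^c-x_{ij}^c\le1$ and $y_i^c+y_j^c-2x_{ij}^c\ge0$ for all $\{i,j\}\in E$, $c\in[k]$; (3) $y_i^c+y_j^c-\bar x_{ij}^c\le1$ and $y_i^c+y_j^c-2\bar x_{ij}^c\ge0$ for all $\{i,j\}\in\bar E$, $c\in[k]$; (4) $\sum_{l\in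 V}(f_{ij}^{lc}+f_{ji}^{lc})\le 2nk\,x_{ij}^c$ for all $\{i,j\}\in E$, $c\in[k]$; (5) for all $(l,j)\in V\times V$, $c\in[k]$: $\sum_{(i,j)\in\delta^-_j}f_{ij}^{lc}-\sum_{(j,i)\in\delta^+_j}f_{ji}^{lc}$ equals $-\sum_{i:\{j,i\}\in\bar E}\bar x_{ji}^c$ if $j=l$, equals $0$ if $\{l,j\}\in E$, and equals $\bar x_{lj}^c$ otherwise; (6) $\sum_{i\in V}y_i^c\ge\alpha$ for all $c\in[k]$. Model $(\mathcal{M}_2)$: let $\mathbb{A}=\{n+1,\dots,n+k\}$ be artificial nodes and $E^k=E\cup\{\{i,j\}:i\in V,j\in\mathbb{A}\}$; arcs and the sets $\delta^\pm_j$ refer to the graph $(V\cup\mathbb{A},E^k)$. Variables $y_i^c\in\{0,1\}$ ($i\in V,c\in[k]$), $x_{ij}\in\{0,1\}$ ($\{i,j\}\in E^k$), and $f_{ij}\ge0$ real for both arcs of each edge of $E^k$. Minimize $\sum_{\{i,j\}\in E}d_{ij}x_{ij}$ subject to: (1) $\sum_{c\in[k]}y_i^c=1$ for all $i\in V$; (2) $y_i^c+y_j^c-x_{ij}\le1$ for all $\{i,j\}\in E$, $c\in[k]$; (3) $y_i^c+y_j^\ell+x_{ij}\le2$ for all $\{i,j\}\in E$, $c,\ell\in[k]$, $c\ne\ell$; (4) $\sum_{j\in V}x_{ij}=1$ and $\sum_{j\in V}f_{ij}=\sum_{j\in V}y_j^{i-n}$ for all $i\in\mathbb{A}$; (5)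 $\sum_{(i,j)\in\delta^-_j}f_{ij}-\sum_{(j,i)\in\delta^+_j}f_{ji}=1$ for all $j\in V$; (6) $f_{ij}+f_{ji}\le\beta x_{ij}$ for all $\{i,j\}\in E$; (7) $\alpha x_{ij}\le f_{ij}\le\beta x_{ij}$ for all $i\in\mathbb{A}$, $j\in V$. *)

(* Defs.v *)
From HB Require Import structures.
From mathcomp Require Import all_boot all_order all_algebra.
From mathcomp Require Import reals.
Set Implicit Arguments.
Unset Strict Implicit.
Unset Printing Implicit Defensive.
Import Order.TTheory GRing.Theory Num.Theory.
Local Open Scope ring_scope.

(* The edge set of a simple graph on N is a set of 2-element subsets of N, so
   that variables indexed by edges are symmetric by construction.  Variables
   are total functions; their values off the index set of the model are
   unconstrained and never used. *)
Definition simple_edges (N : finType) (E : {set {set N}}) : Prop :=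
  {in E, forall e : {set N}, #|e| = 2}.

Definition nonedges (N : finType) (E : {set {set N}}) : {set {set N}} :=
  [set e : {set N} | (#|e| == 2) && (e \notin E)].

Definition induced_edges (N : finType) (E : {set {set N}}) (C : {set N}) :
  {set {set N}} := [set e in E | e \subset C].

Definition is_clique (N : finType) (E : {set {set N}}) (C : {set N}) : Prop :=
  {in C &, forall i j : N, i != j -> [set i; j] \in E}.

(* The pair (i, j) is the arc from i to j. *)
Definition arcs (N : finType) (E : {set {set N}}) : {set N * N} :=
  [set a : N * N | [set a.1; a.2] \in E].

Definition delta_in (N : finType) (E : {set {set N}}) (j : N) : {set N * N} :=
  [set a in arcs E | a.2 == j].

Definition delta_out (N : finType) (E : {set {set N}}) (j : N) : {set N * N} :=
  [set a in arcs E | a.1 == j].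

Definition binary (R : realType) (v : R) : Prop := v = 0 \/ v = 1.

Record opt_model (R : realType) := OptModel {
  solution : Type;
  feasible : solution -> Prop;
  objective : solution -> R   (* to be minimized *)
}.

Definition valid_ge (R : realType) (M : opt_model R)
    (lhs : solution M -> R) (rhs : R) : Prop :=
  forall s : solution M, feasible s -> lhs s >= rhs.

(* In both models the node set V is T, n is #|T| and [k] is 'I_k. *)

Record sol1 (R : realType) (T : finType) (k : nat) := Sol1 {
  y1 : T -> 'I_k -> R;
  x1 : {set T} -> 'I_k -> R;
  xbar1 : {set T} -> 'I_k -> R;
  f1 : T * T -> T -> 'I_k -> R   (* f1 (i, j) l c is f_{ij}^{lc} *)
}.

Record feasible1 (R : realType) (T : finType) (E : {set {set T}})
    (k alpha : nat) (s : sol1 R T k) : Prop := Feasible1 {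
  y1_binary : forall i c, binary (y1 s i c);
  x1_binary : forall e c, e \in E -> binary (x1 s e c);
  xbar1_binary : forall e c, e \in nonedges E -> binary (xbar1 s e c);
  f1_ge0 : forall a l c, a \in arcs E -> 0 <= f1 s a l c;
  m1_assign : forall i, \sum_(c < k) y1 s i c = 1;
  m1_edge : forall i j c, [set i; j] \in E ->
    y1 s i c + y1 s j c - x1 s [set i; j] c <= 1 /\
    y1 s i c + y1 s j c - 2 * x1 s [set i; j] c >= 0;
  m1_nonedge : forall i j c, [set i; j] \in nonedges E ->
    y1 s i c + y1 s j c - xbar1 s [set i; j] c <= 1 /\
    y1 s i c + y1 s j c - 2 * xbar1 s [set i; j] c >= 0;
  m1_capacity : forall i j c, [set i; j] \in E ->
    \sum_(l : T) (f1 s (i, j) l c + f1 s (j, i) l c)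
      <= 2 * #|T|%:R * k%:R * x1 s [set i; j] c;
  m1_flow : forall l j c,
    \sum_(a in delta_in E j) f1 s a l c - \sum_(a in delta_out E j) f1 s a l c
    = if j == l then
        - \sum_(i : T | [set j; i] \in nonedges E) xbar1 s [set j; i] c
      else if [set l; j] \in E then 0
      else xbar1 s [set l; j] c;
  m1_size : forall c, \sum_(i : T) y1 s i c >= alpha%:R
}.

Definition model1 (R : realType) (T : finType) (E : {set {set T}})
    (d : {set T} -> R) (k alpha : nat) : opt_model R :=
  @OptModel R (sol1 R T k) (@feasible1 R T E k alpha)
    (fun s => \sum_(c < k) \sum_(e in E) d e * x1 s e c).

(* The artificial node n + c is inr c, an original node i is inl i. *)
Definition ext_edges (T : finType) (k : nat) (E : {set {set T}}) :
    {set {set (T + 'I_k)%type}} :=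
  [set [set inl i | i in e] | e : {set T} in E]
    :|: [set [set inl i; inr c] | i : T, c : 'I_k].

Record sol2 (R : realType) (T : finType) (k : nat) := Sol2 {
  y2 : T -> 'I_k -> R;
  x2 : {set (T + 'I_k)%type} -> R;
  f2 : (T + 'I_k) * (T + 'I_k) -> R
}.

(* Real-valued, as the difference may be negative (the model is then
   infeasible). *)
Definition beta (R : realType) (T : finType) (k alpha : nat) : R :=
  #|T|%:R - (k%:R - 1) * alpha%:R.

Record feasible2 (R : realType) (T : finType) (E : {set {set T}})
    (k alpha : nat) (s : sol2 R T k) : Prop := Feasible2 {
  y2_binary : forall i c, binary (y2 s i c);
  x2_binary : forall e, e \in ext_edges k E -> binary (x2 s e);
  f2_ge0 : forall a, a \in arcs (ext_edges k E) -> 0 <= f2 s a;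
  m2_assign : forall i, \sum_(c < k) y2 s i c = 1;
  m2_same : forall i j c, [set i; j] \in E ->
    y2 s i c + y2 s j c - x2 s [set inl i; inl j] <= 1;
  m2_diff : forall i j (c l : 'I_k), [set i; j] \in E -> c != l ->
    y2 s i c + y2 s j l + x2 s [set inl i; inl j] <= 2;
  m2_source : forall c : 'I_k,
    \sum_(j : T) x2 s [set inr c; inl j] = 1 /\
    \sum_(j : T) f2 s (inr c, inl j) = \sum_(j : T) y2 s j c;
  m2_flow : forall j : T,
    \sum_(a in delta_in (ext_edges k E) (inl j)) f2 s a
    - \sum_(a in delta_out (ext_edges k E) (inl j)) f2 s a = 1;
  m2_capacity : forall i j, [set i; j] \in E ->
    f2 s (inl i, inl j) + f2 s (inl j, inl i)
      <= beta R T k alpha * x2 s [set inl i; inl j];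
  m2_size : forall (c : 'I_k) (j : T),
    alpha%:R * x2 s [set inr c; inl j] <= f2 s (inr c, inl j) /\
    f2 s (inr c, inl j) <= beta R T k alpha * x2 s [set inr c; inl j]
}.

Definition model2 (R : realType) (T : finType) (E : {set {set T}})
    (d : {set T} -> R) (k alpha : nat) : opt_model R :=
  @OptModel R (sol2 R T k) (@feasible2 R T E k alpha)
    (fun s => \sum_(e in E) d e * x2 s [set inl i | i in e]).

(* Truncated subtraction is harmless where this is used: m > k >= 2. *)
Definition clique_bound (k m : nat) : nat :=
  (let q := m - k in
   if k == 2 then maxn (m./2 * (m./2 - 1)) q else q)%N.

(* Main.v *)
Require Import Defs.
From HB Require Import structures.
From mathcomp Require Import all_boot all_order all_algebra.
From mathcomp Require Import reals.
From mathcomp Require Import zify lra.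
Set Implicit Arguments.
Unset Strict Implicit.
Unset Printing Implicit Defensive.
Import Order.TTheory GRing.Theory Num.Theory.
Local Open Scope ring_scope.

(** A class [c] meets the clique [C] in a clique on [a c] nodes, hence forces
    ['C(a c, 2)] edges inside it to be selected.  Since [a <= 'C(a, 2) + 1],
    summing over the [k] classes gives [#|C| - k]; for [k = 2], convexity of
    ['C(a, 2)] gives the other bound. *)

Lemma leq_bin2S (a : nat) : (a <= 'C(a, 2) + 1)%N.
Proof. by elim: a => // -[|a] IHa //; rewrite binS bin1; lia. Qed.

(** With [H] the half of [a + b], the tangent at [H] gives [a * a >= 2 * H * a - H * H], and
    likewise for [b]. Adding these and using [2 * H <= a + b] yields the bound, for either
    parity. *)
Lemma bin2D_ge (a b : nat) :
  ((a + b)./2 * ((a + b)./2 - 1) <= 'C(a, 2) + 'C(b, 2))%N.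
Proof.
have bin2E m : ('C(m, 2) * 2 + m = m * m)%N.
  by elim: m => // m IHm; rewrite binS bin1; lia.
have : ((a + b)./2 * 2 <= a + b)%N by lia.
move: (_./2) => [|h] h_le; first by rewrite mul0n.
have [a_ge _] := nat_Cauchy h.+1 a; have [b_ge _] := nat_Cauchy h.+1 b.
(* Here [H] is [h.+1]. The factor [h.*2.+1], that is [2 * H - 1], is what multiplies [a + b] once
   the two tangents are added and [a + b] is subtracted. This product is supplied because the goal
   is nonlinear. *)
have h_mul : (h.*2.+1 * (h.+1 * 2) <= h.*2.+1 * (a + b))%N.
  by rewrite leq_mul2l h_le orbT.
by move: (bin2E a) (bin2E b); lia.
Qed.

Lemma clique_bound_le_bin2 (k : nat) (a : 'I_k -> nat) :
  (clique_bound k (\sum_c a c) <= \sum_c 'C(a c, 2))%N.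
Proof.
have q_le : (\sum_c a c - k <= \sum_c 'C(a c, 2))%N.
  (* [k] becomes a sum of ones, one per class, so that the inequality splits classwise. *)
  rewrite leq_subLR -[X in (X + _)%N]card_ord -sum1_card addnC -big_split /=.
  by apply: leq_sum => c _; apply: leq_bin2S.
rewrite /clique_bound; case: eqP => [k2|//].
rewrite geq_max q_le andbT; subst k.
by rewrite !big_ord_recl !big_ord0 !addn0 bin2D_ge.
Qed.

Section ClassMembers.

Variables (R : realType) (T : finType) (k : nat) (y : T -> 'I_k -> R).
Hypothesis y_bin : forall i c, binary (y i c).
Hypothesis y_assign : forall i, \sum_(c < k) y i c = 1.
Variables (E : {set {set T}}) (C : {set T}).
Hypothesis E_simple : simple_edges E.
Hypothesis C_clique : is_clique E C.

Definition members (c : 'I_k) : {set T} := [set i in C | y i c == 1].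

Lemma binary_natr (i : T) (c : 'I_k) : y i c = (y i c == 1)%:R.
Proof.
by case: (y_bin i c) => ->; rewrite ?eqxx // eq_sym oner_eq0.
Qed.

(** Double counting: sum the assignment equations over the nodes of [C] and exchange the sums. *)
Lemma sum_card_members : (\sum_c #|members c| = #|C|)%N.
Proof.
apply/eqP; rewrite -(eqr_nat R) natr_sum -sum1_card natr_sum.
rewrite -(eq_bigr _ (fun i _ => y_assign i)) exchange_big /=.
apply/eqP/eq_bigr => c _; rewrite -sum1_card natr_sum.
under eq_bigl do rewrite inE.
rewrite big_mkcondr; apply: eq_bigr => i _.
by rewrite [RHS]binary_natr; case: eqP.
Qed.

(** Every edge is a pair, and every pair inside the clique is an edge, so pairs of members are
    counted. *)
Lemma card_edges_members (c : 'I_k) :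
  #|[set e in induced_edges E C | e \subset members c]| = 'C(#|members c|, 2).
Proof.
rewrite -cards_draws; apply: eq_card => e; rewrite !inE.
have [sub_e | _] := boolP (e \subset members c); last by rewrite andbF.
have subC : e \subset C.
  by apply: subset_trans sub_e _; apply/subsetP => i; rewrite inE => /andP[].
rewrite subC !andbT /=; apply/idP/idP => [/E_simple -> // | /cards2P].
case=> i [j [ne_ij def_e]].
have [iC jC] : i \in C /\ j \in C.
  by split; apply: (subsetP subC); rewrite def_e !inE eqxx ?orbT.
by rewrite def_e; apply: C_clique.
Qed.

(** The right-hand side involves only the partition, so both models can be compared with it. *)
Lemma clique_bound_le_sum :
  (clique_bound k #|C|)%:R
    <= \sum_(e in induced_edges E C) \sum_c (e \subset members c)%:R :> R.
Proof.
rewrite exchange_big /=.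
apply: le_trans (_ : (\sum_c 'C(#|members c|, 2))%:R <= _).
  by rewrite ler_nat -sum_card_members clique_bound_le_bin2.
rewrite natr_sum ler_sum // => c _.
rewrite -card_edges_members -sum1_card natr_sum.
under eq_bigl do rewrite inE.
by rewrite big_mkcondr; apply: ler_sum => e _; case: ifP.
Qed.

Lemma members_edgeP (e : {set T}) (c : 'I_k) :
    e \in E -> e \subset members c ->
  exists i j, [/\ e = [set i; j], y i c = 1 & y j c = 1].
Proof.
move=> /E_simple/eqP/cards2P[i [j [_ ->]]]; rewrite subUset !sub1set !inE.
by case/andP => /andP[_ /eqP yi] /andP[_ /eqP yj]; exists i, j.
Qed.

(** Each indicator is at most [y i c] for a fixed end [i] of [e], and these sum to 1. This serves
    the second model, whose edge variables carry no class index. *)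
Lemma sum_subset_members_le1 (e : {set T}) :
  e \in E -> \sum_c (e \subset members c)%:R <= 1 :> R.
Proof.
move=> /E_simple/eqP/cards2P[i [j [_ ->]]]; rewrite -[leRHS](y_assign i).
apply: ler_sum => c _; rewrite subUset !sub1set !inE [leRHS]binary_natr ler_nat.
by case: (y i c == 1); rewrite ?andbF ?leq_b1.
Qed.

End ClassMembers.

Lemma binary_ge0 (R : realType) (v : R) : binary v -> 0 <= v.
Proof. by case=> ->; rewrite ?ler01. Qed.

Theorem theorem10 (R : realType) (T : finType) (E : {set {set T}})
    (hE : simple_edges E) (d : {set T} -> R)
    (hd : forall e : {set T}, e \in E -> 0 <= d e)
    (k alpha : nat) (hk : (2 <= k)%N) (halpha : (2 <= alpha)%N)
    (C : {set T}) (hC : is_clique E C) (hCk : (k < #|C|)%N) :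
  @valid_ge R (model1 E d k alpha)
    (fun s => \sum_(c < k) \sum_(e in induced_edges E C) x1 s e c)
    (clique_bound k #|C|)%:R
  /\
  @valid_ge R (model2 E d k alpha)
    (fun s => \sum_(e in induced_edges E C) x2 s [set inl i | i in e])
    (clique_bound k #|C|)%:R.
Proof.
split=> /= s [].
- move=> y_bin x_bin _ _ y_assign x_edge _ _ _ _.
  apply: le_trans (clique_bound_le_sum y_bin y_assign hE hC) _.
  rewrite exchange_big /=; apply: ler_sum => c _; apply: ler_sum => e.
  rewrite inE => /andP[eE _].
  have [sub_e | _] := boolP (e \subset _); last exact/binary_ge0/x_bin.
  have [i [j] [def_e yi yj]] := members_edgeP hE eE sub_e.
  (* With both ends in class [c], the linking constraint reads [2 - x <= 1]. *)
  by move: eE; rewrite def_e => /(x_edge _ _ c)[]; rewrite yi yj /=; lra.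
- move=> y_bin x_bin _ y_assign x_same _ _ _ _ _.
  apply: le_trans (clique_bound_le_sum y_bin y_assign hE hC) _.
  apply: ler_sum => e; rewrite inE => /andP[eE _].
  have [/existsP[c sub_e] | /existsPn none] :=
    boolP [exists c, e \subset members (y2 s) C c].
    apply: le_trans (sum_subset_members_le1 y_bin y_assign C hE eE) _.
    have [i [j] [def_e yi yj]] := members_edgeP hE eE sub_e.
    move: eE; rewrite def_e imsetU1 imset_set1 => /(x_same _ _ c).
    by rewrite yi yj; lra.
  (* No class contains [e]: the sum vanishes and nonnegativity of the edge variable is enough. *)
  rewrite big1 => [|c _]; last by rewrite (negbTE (none c)).
  by apply/binary_ge0/x_bin; rewrite inE imset_f.
Qed.
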